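(* Let $H$ be a Bellamy continuum, let $S$ be the set of coastal points of $H$, and suppose $\varnothing\ne S\ne H$. Then $S$ is a semicontinuum with dense interior, and $S$ contains every proper semicontinuum of $H$ with nonempty interior. Moreover $H-S^\circ$ is a subcontinuum of $H$, and one of the following holds: (1) the semicontinuum $S$ is open in $H$; (2) $H-S^\circ$ is an indecomposable continuum with more than one composant.
   Context: A continuum is a compact connected Hausdorff space (not assumed metrisable). $B^\circ$ denotes the interior of $B$. A continuum is indecomposable if it is not the union of two proper subcontinua. For a continuum $X$ and $p\in X$, the composant $\kappa(p)$ is the union of all proper subcontinua of $X$ that include $p$; a composant of $X$ is a set of this form. A Bellamy continuum is an indecomposable continuum with exactly one composant. A semicontinuum is a space $T$ such that any two points $a,b\in T$ lie in some continuum $K\subset T$. The continuum components of a Hausdorff space are its maximal continuumwise connected subspaces (maximal semicontinua). For distinct $x,p\in X$, $\kappa(x;p)$ is the continuum component of $x$ in $X-p$. A point $x\in X$ is coastal if $\kappa(x;p)$ is dense in $X$ for some $p\in X$ (equivalently, $x$ lies in a dense proper semicontinuum of $X$). *)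

(* Defs.v *)
From mathcomp Require Import all_boot.
From mathcomp Require Import boolp classical_sets.
From mathcomp Require Import topology.

Set Implicit Arguments.
Unset Strict Implicit.
Unset Printing Implicit Defensive.

Local Open Scope classical_set_scope.

(* Continua are handled as subsets of an ambient space X, a space itself being
   the subset [set: X]. Compactness and connectedness of A : set X agree with
   those of the subspace A. The Hausdorff axiom is inherited by subspaces, so
   it is not repeated here: these notions are meant for Hausdorff X. Continua
   are nonempty and may be singletons. *)
Definition continuum (X : topologicalType) (A : set X) : Prop :=
  [/\ A !=set0, compact A & connected A].

Definition subcontinuum (X : topologicalType) (C K : set X) : Prop :=
  continuum K /\ K `<=` C.

Definition proper_subcontinuum (X : topologicalType) (C K : set X) : Prop :=
  subcontinuum C K /\ K <> C.

Definition indecomposable (X : topologicalType) (C : set X) : Prop :=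
  continuum C /\
  ~ (exists A B : set X,
      [/\ proper_subcontinuum C A, proper_subcontinuum C B & C = A `|` B]).

Definition composant (X : topologicalType) (C : set X) (p : X) : set X :=
  \bigcup_(K in [set K | proper_subcontinuum C K /\ K p]) K.

Definition composants (X : topologicalType) (C : set X) : set (set X) :=
  [set composant C p | p in C].

Definition bellamy (X : topologicalType) (C : set X) : Prop :=
  indecomposable C /\ exists K : set X, composants C = [set K].

Definition semicontinuum (X : topologicalType) (T : set X) : Prop :=
  forall a b : X, T a -> T b ->
    exists K : set X, [/\ continuum K, K `<=` T, K a & K b].

(* D is a continuum component of the subspace A. *)
Definition continuum_component (X : topologicalType) (A D : set X) : Prop :=
  [/\ semicontinuum D, D `<=` A &
      forall E : set X, semicontinuum E -> E `<=` A -> D `<=` E -> E = D].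

(* The set D below is the continuum component of x in X - p, which is unique:
   the union of two semicontinua sharing a point is a semicontinuum. *)
Definition coastal (X : topologicalType) : set X :=
  [set x | exists2 p : X, p <> x &
    exists D : set X,
      [/\ continuum_component (~` [set p]) D, D x & dense D]].
Arguments coastal X : clear implicits.

(* Main.v *)
Require Import Defs.
From mathcomp Require Import all_boot.
From mathcomp Require Import boolp classical_sets topology.
Local Open Scope classical_set_scope.

(** Write S for the set of coastal points. It is the union of all dense proper
semicontinua. As H is a nondegenerate Bellamy continuum, any two of its points
lie in a common proper subcontinuum; as H is indecomposable, such a
subcontinuum is nowhere dense ([indecomposable_interior]).

The engine of the proof is maximality. Two dense proper semicontinua either meet
or are joined by a proper subcontinuum that does not fill H when added to one of
them, so S is itself a semicontinuum ([coastal_semicontinuum]). Since S is dense, a continuum C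
meeting both S and its complement makes S together with C a dense semicontinuum
strictly larger than S, which therefore cannot be proper: C contains every
noncoastal point ([noncoastal_sub_continuum]). Everything else follows.
- A proper subcontinuum K joining a coastal point to a noncoastal one contains
  the complement of S, so S contains the open dense complement of K.
- A proper semicontinuum with nonempty interior is dense, because its closure
  is a continuum with nonempty interior; hence it lies in S.
- Let M be the complement of the interior of S, that is, the closure of the
  complement of S. If M split into disjoint closed pieces A and B, boundary
  bumping ([continuum_leaving_open]) would give a continuum that starts at a
  noncoastal point of A, avoids a neighbourhood of B and yet leaves a
  neighbourhood of A, so enters S. It would have to contain the noncoastal
  points of B, which it avoids.
- A proper subcontinuum of M cannot meet both S and its complement, since it
  would then contain the complement of S, and so M. If S is not open, M itself
  meets both; then M is indecomposable, and the composants of a point in S and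
  of a point outside S lie on different sides. *)

(** * Separation and connectedness *)

Lemma disjoint_closed_separation {X : topologicalType} {A B : set X} :
  hausdorff_space X -> compact [set: X] -> closed A -> closed B ->
  A `&` B = set0 ->
  exists U V : set X,
    [/\ open U, open V, A `<=` U, B `<=` V & U `&` V = set0].
Proof.
move=> hX cX cA cB AB0.
have [|C sC CB] := @compact_normal X hX cX A cA (~` B).
- move=> x Ax; apply: open_nbhs_nbhs; split; first exact: closed_openC.
  by move=> Bx; have : (A `&` B) x by []; rewrite AB0.
exists (interior C), (~` closure C); split.
- exact: open_interior.
- exact/closed_openC/closed_closure.
- exact: sC.
- by move=> x Bx /CB.
- apply/seteqP; split=> // x [Cx nCx].
  by exfalso; apply: nCx; apply: subset_closure; apply: interior_subset.
Qed.

(** The second hypothesis on B says that B is open relative to A. *)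
Lemma connected_sub_or_disjoint {X : topologicalType} {A B : set X} :
  connected A -> closed B -> (exists2 C, closed C & A `\` B = A `&` C) ->
  A `<=` B \/ A `&` B = set0.
Proof.
move=> cA clB [C clC ABC].
have [AB|AB0] := pselect (A `&` B !=set0); last first.
  by right; apply/seteqP; split=> // x ABx; apply: AB0; exists x.
left; suff <- : A `&` B = A by apply: subIsetr.
apply: cA => //; last by exists B.
exists (~` C); first exact: closed_openC.
rewrite -setDE; apply/seteqP; split=> x [Ax].
  move=> Bx; split=> // Cx; have : (A `\` B) x by rewrite ABC.
  by case.
move=> nCx; split=> //; apply: contrapT => nBx.
by have : (A `\` B) x by []; rewrite ABC => -[].
Qed.

(** When A is closed, relatively closed and relatively open subsets of A can be
    described by closed sets of the whole space. *)
Lemma closed_connected {X : topologicalType} {A : set X} : closed A ->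
  (forall F, F `<=` A -> closed F -> closed (A `\` F) -> F !=set0 ->
     F = A) -> connected A.
Proof.
move=> clA AF B B0 [C oC BC] [D clD BD]; apply: AF => //.
- by rewrite BC; apply: subIsetl.
- by rewrite BD; apply: closedI.
- rewrite BC setDIr setDv set0U setDE; apply: closedI => //.
  exact: open_closedC.
Qed.

Lemma connected_space_clopen {X : topologicalType} {Q : set X} :
  connected [set: X] -> open Q -> closed Q -> Q !=set0 -> Q = setT.
Proof.
by move=> cX oQ clQ Q0; apply: cX => //; exists Q => //; rewrite setTI.
Qed.

(** A set that is clopen in K together with U either contains K or misses it,
    since K is connected. So that set or its complement lies in U; being closed,
    and open because U is, it is clopen in the whole space. *)
Lemma connected_setU_open {X : topologicalType} {K U : set X} :
  connected [set: X] -> connected K -> K !=set0 -> open U ->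
  closed (K `|` U) -> connected (K `|` U).
Proof.
move=> cX cK [k Kk] oU clKU; apply: closed_connected => // F FKU clF clF' F0.
have [|KF|KF0] := @connected_sub_or_disjoint X K F cK clF.
- exists ((K `|` U) `\` F) => //; apply/seteqP; split=> x [Kx].
    by move=> nFx; split=> //; split=> //; left.
  by case.
- apply/seteqP; split=> // x KUx; apply: contrapT => nFx.
  have E : (K `|` U) `\` F = U `\` F.
    apply/seteqP; split=> y [].
      by case=> [/KF//|Uy nFy].
    by move=> Uy nFy; split=> //; right.
  suff /seteqP[_ /(_ k I)[_]] : (K `|` U) `\` F = setT by apply; exact: KF.
  apply: connected_space_clopen => //; last by exists x.
  by rewrite E; apply: openI => //; apply: closed_openC.
- have E : F = U `&` ~` ((K `|` U) `\` F).
    apply/seteqP; split=> x.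
      move=> Fx; split; last by case.
      case: (FKU x Fx) => // Kx.
      by have : (K `&` F) x by []; rewrite KF0.
    move=> [Ux nx]; apply: contrapT => nFx; apply: nx.
    by split=> //; right.
  have FT : F = setT.
    apply: connected_space_clopen => //.
    by rewrite E; apply: openI => //; apply: closed_openC.
  by have : (K `&` F) k by [rewrite FT]; rewrite KF0.
Qed.

(** * Quasicomponents and boundary bumping *)

Definition clopen_in {X : topologicalType} (L F : set X) : Prop :=
  [/\ F `<=` L, closed F & closed (L `\` F)].

Definition quasicomponent {X : topologicalType} (L : set X) (p : X) : set X :=
  \bigcap_(F in [set F | clopen_in L F /\ F p]) F.

Lemma clopen_inI {X : topologicalType} {L F G : set X} :
  clopen_in L F -> clopen_in L G -> clopen_in L (F `&` G).
Proof.
move=> [FL clF clF'] [GL clG clG']; split.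
- by move=> x [/FL].
- exact: closedI.
- by rewrite setDIr; apply: closedU.
Qed.

Lemma clopen_in_id {X : topologicalType} {L : set X} :
  closed L -> clopen_in L L.
Proof. by move=> clL; split=> //; rewrite setDv; apply: closed0. Qed.

(** Compactness: the relatively clopen sets containing p are closed under
    finite intersections, so if none of them fitted inside V, their traces
    outside V would have a common cluster point, which belongs to the
    quasicomponent. *)
Lemma quasicomponent_nbhs {X : topologicalType} {L V : set X} {p : X} :
  closed L -> compact L -> L p -> open V -> quasicomponent L p `<=` V ->
  exists F, [/\ clopen_in L F, F p & F `<=` V].
Proof.
move=> clL cL Lp oV QV; apply: contrapT => noF.
pose D := [set F | clopen_in L F /\ F p].
pose G := filter_from D (fun F => F `\` V).
have DL : D L by split=> //; apply: clopen_in_id.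
have FG : Filter G.
  apply: filter_from_filter; first by exists L.
  move=> E F [cE Ep] [cF Fp]; exists (E `&` F); last by move=> x [[]].
  by split=> //; apply: clopen_inI.
have PG : ProperFilter G.
  apply: filter_from_proper => F [cF Fp].
  apply: contrapT => FV0; apply: noF; exists F; split=> // x Fx.
  by apply: contrapT => nVx; apply: FV0; exists x.
have [|x [Lx]] := cL G PG; first by exists L => // x [].
rewrite clusterE => clx.
have inD F : D F -> (F `\` V) x.
  move=> DF; have /closure_id -> : closed (F `\` V).
    by case: DF => -[_ clF _] _; rewrite setDE; apply: closedI => //;
       apply: open_closedC.
  by apply: clx; exists F.
have [_] := inD L DL; apply; apply: QV => F DF.
by have [] := inD F DF.
Qed.

(** In a compact Hausdorff space a quasicomponent is connected. If it were the
    disjoint union of closed sets A and B with p in A, separate them by open U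
    and V; some relatively clopen F around p lies in the union of U and V, and
    then the part of F inside U is relatively clopen too and cuts off B. *)
Lemma quasicomponent_connected {X : topologicalType} {L : set X} {p : X} :
  hausdorff_space X -> compact [set: X] -> closed L -> L p ->
  connected (quasicomponent L p).
Proof.
move=> hX cX clL Lp.
have clQ : closed (quasicomponent L p).
  by apply: closed_bigI => F [[_ clF _] _].
have Qp : quasicomponent L p p by move=> F [].
have key A B : closed A -> closed B -> A `&` B = set0 ->
    A `|` B = quasicomponent L p -> A p -> B = set0.
  move=> clA clB AB0 ABQ Ap.
  have [U [V [oU oV AU BV UV0]]] :=
    disjoint_closed_separation hX cX clA clB AB0.
  have cL : compact L by apply: subclosed_compact clL cX _.
  have [|F [[FL clF clF'] Fp FUV]] :=
      @quasicomponent_nbhs X L (U `|` V) p clL cL Lp (openU oU oV).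
    by rewrite -ABQ => x [/AU|/BV]; [left|right].
  have FUE : F `&` U = F `&` ~` V.
    apply/seteqP; split=> x [Fx].
      move=> Ux; split=> // Vx.
      by have : (U `&` V) x by []; rewrite UV0.
    by move=> nVx; split=> //; case: (FUV x Fx).
  have cFU : clopen_in L (F `&` U).
    split; first by move=> x [/FL].
      by rewrite FUE; apply: closedI => //; apply: open_closedC.
    rewrite setDIr; apply: closedU => //.
    by rewrite setDE; apply: closedI => //; apply: open_closedC.
  apply/seteqP; split=> // x Bx.
  have : (F `&` U) x.
    have Qx : quasicomponent L p x by rewrite -ABQ; right.
    by apply: Qx; split=> //; split=> //; apply: AU.
  by case=> _ Ux; have : (U `&` V) x by [split=> //; apply: BV]; rewrite UV0.
apply: closed_connected => // F FQ clF clF' [z Fz].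
have QE : F `|` (quasicomponent L p `\` F) = quasicomponent L p.
  apply/seteqP; split=> x; first by case=> [/FQ|[]].
  by have [Fx|nFx] := pselect (F x); [left|right].
have [Fp|nFp] := pselect (F p).
  rewrite -[RHS]QE (key F (quasicomponent L p `\` F)) ?setU0 //.
  by apply/seteqP; split=> // x [Fx []].
suff F0 : F = set0 by move: Fz; rewrite F0.
apply: (key (quasicomponent L p `\` F) F) => //; last by rewrite setUC.
by apply/seteqP; split=> // x [[]].
Qed.

(** Boundary bumping. The quasicomponent of p in L works: were it contained
    in U, some relatively clopen subset of L would lie between them, and this
    set would be clopen in the whole connected space. *)
Lemma continuum_leaving_open {X : topologicalType} {U L : set X} {p : X} :
  hausdorff_space X -> compact [set: X] -> connected [set: X] ->
  open U -> U p -> closed L -> U `<=` L -> L <> setT ->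
  exists C : set X, [/\ continuum C, C p, C `<=` L & C `\` U !=set0].
Proof.
move=> hX cX conX oU Up clL UL LT.
have Lp : L p by apply: UL.
have Qp : quasicomponent L p p by move=> F [].
exists (quasicomponent L p); split => //.
- split; first by exists p.
    apply: subclosed_compact cX _ => //.
    by apply: closed_bigI => F [[_ clF _] _].
  exact: quasicomponent_connected.
- by move=> x Qx; apply: Qx; split=> //; apply: clopen_in_id.
- apply: contrapT => QU0.
  have QU : quasicomponent L p `<=` U.
    by move=> x Qx; apply: contrapT => nUx; apply: QU0; exists x.
  have cL : compact L by apply: subclosed_compact clL cX _.
  have [F [[FL clF clF'] Fp FU]] := quasicomponent_nbhs clL cL Lp oU QU.
  apply: LT; suff FT : F = setT.
    by apply/seteqP; split=> // x _; apply: FL; rewrite FT.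
  apply: connected_space_clopen => //; last by exists p.
  have -> : F = U `&` ~` (L `\` F).
    apply/seteqP; split=> x.
      by move=> Fx; split; [apply: FU|case].
    move=> [Ux nx]; apply: contrapT => nFx; apply: nx.
    by split=> //; apply: UL.
  by apply: openI => //; apply: closed_openC.
Qed.

(** * Continua and semicontinua *)

Lemma continuum1 {X : topologicalType} (x : X) : continuum [set x].
Proof.
by split; [exists x | apply: compact_set1 | apply: connected1].
Qed.

Lemma continuumU {X : topologicalType} {K L : set X} :
  continuum K -> continuum L -> K `&` L !=set0 -> continuum (K `|` L).
Proof.
move=> [[k Kk] cK conK] [_ cL conL] KL; split; first by exists k; left.
  exact: compactU.
exact: connectedU.
Qed.

Lemma closed_proper_subcontinuum {X : topologicalType} {A : set X} :
  compact [set: X] -> closed A -> A !=set0 -> connected A -> A <> setT ->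
  proper_subcontinuum [set: X] A.
Proof.
move=> cX clA A0 conA AT.
have cA : compact A by exact: subclosed_compact clA cX _.
by split; [split; [split|]|].
Qed.

Lemma continuum_semicontinuum {X : topologicalType} {K : set X} :
  continuum K -> semicontinuum K.
Proof. by move=> cK a b Ka Kb; exists K; split. Qed.

Lemma semicontinuum_bigcup {X : topologicalType} {E : set (set X)} {x : X} :
  (forall T, E T -> semicontinuum T /\ T x) ->
  semicontinuum (\bigcup_(T in E) T).
Proof.
move=> ET a b [T1 E1 T1a] [T2 E2 T2b].
have [s1 T1x] := ET _ E1; have [s2 T2x] := ET _ E2.
have [K [cK KT Ka Kx]] := s1 a x T1a T1x.
have [L [cL LT Lx Lb]] := s2 x b T2x T2b.
exists (K `|` L); split; [|by move=> y [/KT|/LT]; [exists T1|exists T2]|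
  by left|by right].
by apply: continuumU => //; exists x.
Qed.

Lemma semicontinuumU {X : topologicalType} {T1 T2 : set X} :
  semicontinuum T1 -> semicontinuum T2 -> T1 `&` T2 !=set0 ->
  semicontinuum (T1 `|` T2).
Proof.
move=> s1 s2 [x [T1x T2x]].
suff -> : T1 `|` T2 = \bigcup_(T in [set T1; T2]) T.
  by apply: (@semicontinuum_bigcup X _ x) => T [] ->.
by rewrite bigcup_setU !bigcup_set1.
Qed.

Lemma semicontinuum_connected {X : topologicalType} {T : set X} :
  semicontinuum T -> connected T.
Proof.
move=> sT; have [[x Tx]|T0] := pselect (T !=set0); last first.
  suff -> : T = set0 by apply: connected0.
  by apply/seteqP; split=> // x Tx; apply: T0; exists x.
have -> : T = \bigcup_(K in [set K | [/\ continuum K, K `<=` T & K x]]) K.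
  apply/seteqP; split=> y; last by move=> [K [_ + _]]; apply.
  by move=> Ty; have [K [cK KT Kx Ky]] := sT x y Tx Ty; exists K.
apply: bigcup_connected; first by exists x => K [].
by move=> K [[]].
Qed.

(** * Indecomposable and Bellamy continua *)

(** If the complement W of K is connected, then K and the closure of W
    decompose the space as soon as K has an interior point. If W splits into
    open sets B and V, then K with B and K with V do. *)
Lemma indecomposable_interior {X : topologicalType} {K : set X} :
  hausdorff_space X -> indecomposable [set: X] ->
  proper_subcontinuum [set: X] K -> interior K = set0.
Proof.
move=> hX [[_ cX conX] indX] pK; have [[[K0 cK conK] _] KT] := pK.
have clK : closed K by apply: compact_closed.
have oW : open (~` K) by apply: closed_openC.
have [w nKw] : (~` K) !=set0.
  apply: contrapT => W0; apply: KT; apply/seteqP; split=> // x _.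
  by apply: contrapT => nKx; apply: W0; exists x.
apply/seteqP; split=> // k Kk.
have [conW|] := pselect (connected (~` K)).
  apply: indX; exists K, (closure (~` K)); split=> //.
    apply: closed_proper_subcontinuum => //.
    - exact: closed_closure.
    - by exists w; apply: subset_closure.
    - exact: connected_closure.
    - move=> E; have : (~` closure (~` K)) k by rewrite -interiorC setCK.
      by rewrite E; apply.
  apply/seteqP; split=> // x _.
  by have [Kx|nKx] := pselect (K x); [left|right; apply: subset_closure].
move=> nW; apply: nW => B B0 [C oC BC] [D clD BD].
apply: contrapT => BW.
have oB : open B by rewrite BC; apply: openI.
have WBE : ~` K `\` B = ~` K `&` ~` D.
  by rewrite BD setDIr setDv set0U setDE.
have oV : open (~` K `\` B).
  by rewrite WBE; apply: openI => //; apply: closed_openC.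
have [v Vv] : (~` K `\` B) !=set0.
  apply: contrapT => V0; apply: BW; apply/seteqP; split.
    by rewrite BC; apply: subIsetl.
  by move=> x nKx; apply: contrapT => nBx; apply: V0; exists x.
have BK x : B x -> ~ K x by rewrite BC => -[].
have E1 : K `|` B = ~` (~` K `\` B).
  apply/seteqP; split=> x; first by case=> [Kx []//|Bx []].
  move=> nx; have [Kx|nKx] := pselect (K x); first by left.
  by right; apply: contrapT => nBx; apply: nx.
have E2 : K `|` (~` K `\` B) = ~` B.
  apply/seteqP; split=> x; first by case=> [Kx /BK//|[]].
  move=> nBx; have [Kx|nKx] := pselect (K x); first by left.
  by right.
have cl1 : closed (K `|` B) by rewrite E1; apply: open_closedC.
have cl2 : closed (K `|` (~` K `\` B)) by rewrite E2; apply: open_closedC.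
have [b Bb] := B0.
apply: indX; exists (K `|` B), (K `|` (~` K `\` B)); split.
- apply: closed_proper_subcontinuum => //.
    by have [y] := K0; exists y; left.
    exact: connected_setU_open.
  by move/seteqP => [_ /(_ v I)]; rewrite E1; apply.
- apply: closed_proper_subcontinuum => //.
    by have [y] := K0; exists y; left.
    exact: connected_setU_open.
  by move/seteqP => [_ /(_ b I)]; rewrite E2; apply.
- apply/seteqP; split=> // x _.
  have [Kx|nKx] := pselect (K x); first by left; left.
  by have [Bx|nBx] := pselect (B x); [left; right|right; right].
Qed.

(** Since the singleton of x is a proper subcontinuum, x lies in its own
    composant, which is also the composant of y. *)
Lemma bellamy_proper_subcontinuum {X : topologicalType} {x y : X} :
  bellamy [set: X] -> x <> y ->
  exists K, [/\ proper_subcontinuum [set: X] K, K x & K y].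
Proof.
move=> [_ [K cK]] xy.
have compK p : composant [set: X] p = K.
  suff : composants [set: X] (composant [set: X] p) by rewrite cK.
  by exists p.
have : composant [set: X] y x.
  rewrite compK -(compK x); exists [set x] => //=; split=> //.
  split; first by split=> //; apply: continuum1.
  by move=> E; apply: xy; have : [set x] y by rewrite E.
by move=> [L [pL Ly] Lx]; exists L.
Qed.

(** * Coastal points *)

Lemma dense_subset {X : topologicalType} {A B : set X} :
  A `<=` B -> dense A -> dense B.
Proof.
move=> AB dA O O0 oO; have [x [Ox Ax]] := dA O O0 oO.
by exists x; split=> //; apply: AB.
Qed.

(** Given T and a point p outside it, the union of all semicontinua through x
    that avoid p is the continuum component required by the definition. *)
Lemma coastalP {X : topologicalType} {x : X} :
  coastal X x <->
  exists T : set X, [/\ semicontinuum T, dense T, T <> setT & T x].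
Proof.
split=> [[p _ [D [[sD Dp _] Dx dD]]]|[T [sT dT TT Tx]]].
  by exists D; split=> // DT; have := Dp p; rewrite DT => /(_ I); apply.
have [p nTp] : exists p, ~ T p.
  apply: contrapT => noP; apply: TT; apply/seteqP; split=> // p _.
  by apply: contrapT => nTp; apply: noP; exists p.
exists p; first by move=> px; apply: nTp; rewrite px.
pose E := [set T' : set X | [/\ semicontinuum T', T' x & ~ T' p]].
have sub T' : E T' -> T' `<=` \bigcup_(T0 in E) T0 by move=> ET' y; exists T'.
have ET : E T by [].
exists (\bigcup_(T' in E) T'); split;
  [|exact: sub T ET x Tx|exact: dense_subset (sub T ET) dT].
split.
- by apply: (@semicontinuum_bigcup X _ x) => T' [].
- by move=> y [T' [_ _ nT'p] T'y] yp; apply: nT'p; rewrite -yp.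
- move=> F sF Fp EF; apply/seteqP; split=> //.
  apply: (sub); split=> //; first by apply: EF; exact: sub T ET x Tx.
  by move=> Fp'; apply: (Fp p Fp').
Qed.

Lemma dense_semicontinuum_coastal {X : topologicalType} {T : set X} :
  semicontinuum T -> dense T -> T <> setT -> T `<=` coastal X.
Proof. by move=> sT dT TT x Tx; apply/coastalP; exists T. Qed.

Lemma coastal_dense {X : topologicalType} :
  coastal X !=set0 -> dense (coastal X).
Proof.
move=> [x /coastalP[T [sT dT TT _]]].
exact: dense_subset (dense_semicontinuum_coastal sT dT TT) dT.
Qed.

Lemma closed_proper_not_dense {X : topologicalType} {K T : set X} :
  closed K -> K <> setT -> dense T -> ~ (T `<=` K).
Proof.
move=> clK KT dT TK.
have [||x [nKx /TK//]] := dT (~` K); last exact: closed_openC.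
apply: contrapT => K0; apply: KT; apply/seteqP; split=> // x _.
by apply: contrapT => nKx; apply: K0; exists x.
Qed.

(** Let T1 and T2 be dense proper semicontinua through x and y, and let K be a
    proper subcontinuum joining x to y. Either T1 together with K is still
    proper, so K consists of coastal points, or T2 meets T1. *)
Lemma coastal_semicontinuum {X : topologicalType} :
  hausdorff_space X -> bellamy [set: X] -> semicontinuum (coastal X).
Proof.
move=> hX bX x y /coastalP[T1 [s1 d1 T1T T1x]] /coastalP[T2 [s2 d2 T2T T2y]].
have sub1 := dense_semicontinuum_coastal s1 d1 T1T.
have sub2 := dense_semicontinuum_coastal s2 d2 T2T.
have [->|xy] := pselect (x = y).
  by exists [set y]; split=> //; [apply: continuum1|move=> _ ->; apply: sub2].
have [K [[[cK _] KT] Kx Ky]] := bellamy_proper_subcontinuum bX xy.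
have clK : closed K by case: cK => _ /(compact_closed hX).
have sU : semicontinuum (T1 `|` K).
  apply: semicontinuumU => //; first exact: continuum_semicontinuum.
  by exists x.
have dU : dense (T1 `|` K) by apply: dense_subset d1; apply: subsetUl.
have [UT|UT] := pselect (T1 `|` K = setT); last first.
  exists K; split=> // z Kz.
  by apply: (dense_semicontinuum_coastal sU dU UT); right.
(* T1 contains the complement of K, and the dense T2 is not inside K. *)
have T12 : T1 `&` T2 !=set0.
  apply: contrapT => T120; apply: (closed_proper_not_dense clK KT d2) => z T2z.
  have : (T1 `|` K) z by rewrite UT.
  by case=> // T1z; exfalso; apply: T120; exists z.
have [L [cL LT Lx Ly]] :=
  semicontinuumU s1 s2 T12 x y (or_introl T1x) (or_intror T2y).
by exists L; split=> // z /LT[/sub1|/sub2].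
Qed.

(** Maximality of the set of coastal points among dense proper semicontinua:
    enlarging it by C can only produce the whole space. *)
Lemma noncoastal_sub_continuum {X : topologicalType} {C : set X} :
  hausdorff_space X -> bellamy [set: X] -> continuum C ->
  C `&` coastal X !=set0 -> ~ (C `<=` coastal X) -> ~` coastal X `<=` C.
Proof.
move=> hX bX cC [c [Cc Sc]] CS z nSz.
have sU : semicontinuum (coastal X `|` C).
  apply: semicontinuumU; last by exists c.
    exact: coastal_semicontinuum.
  exact: continuum_semicontinuum.
have dU : dense (coastal X `|` C).
  by apply: dense_subset (coastal_dense _); [apply: subsetUl|exists c].
have [UT|UT] := pselect (coastal X `|` C = setT).
  have : (coastal X `|` C) z by rewrite UT.
  by case.
exfalso; apply: CS => w Cw.
by apply: (dense_semicontinuum_coastal sU dU UT); right.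
Qed.

(** The closure of T is a continuum with nonempty interior, hence the whole
    space, so T is dense. *)
Lemma semicontinuum_interior_coastal {X : topologicalType} {T : set X} :
  hausdorff_space X -> indecomposable [set: X] ->
  semicontinuum T -> T <> setT -> interior T !=set0 -> T `<=` coastal X.
Proof.
move=> hX indX sT TT [t iTt].
have [[_ cX _] _] := indX.
have clT : closure T = setT.
  apply: contrapT => clTT.
  suff E : interior (closure T) = set0.
    suff : interior (closure T) t by rewrite E.
    exact: interiorS (@subset_closure _ T) _ iTt.
  apply: indecomposable_interior => //; apply: closed_proper_subcontinuum => //.
  - exact: closed_closure.
  - by exists t; apply: subset_closure; apply: interior_subset.
  - exact/connected_closure/semicontinuum_connected.
apply: dense_semicontinuum_coastal => // O [o Oo] oO.
have : closure T o by rewrite clT.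
by move/(_ O (open_nbhs_nbhs (conj oO Oo))) => [z [Tz Oz]]; exists z.
Qed.

(** * The closure of the set of noncoastal points *)

(** A proper subcontinuum joining a coastal point to a noncoastal one contains
    all noncoastal points and is nowhere dense. *)
Lemma coastal_interior_dense {X : topologicalType} :
  hausdorff_space X -> bellamy [set: X] ->
  coastal X !=set0 -> ~` coastal X !=set0 -> dense (interior (coastal X)).
Proof.
move=> hX bX [s Ss] [p nSp].
have sp : s <> p by move=> sp; apply: nSp; rewrite -sp.
have [K [pK Ks Kp]] := bellamy_proper_subcontinuum bX sp.
have K0 := indecomposable_interior hX bX.1 pK; have [[cK _] _] := pK.
have clK : closed K by case: cK => _ /(compact_closed hX).
have nSK : ~` coastal X `<=` K.
  by apply: noncoastal_sub_continuum => //; [exists s|move/(_ p Kp)].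
have KS : ~` K `<=` interior (coastal X).
  rewrite -open_subsetE; last exact: closed_openC.
  by move=> z nKz; apply: contrapT => /nSK.
apply: (dense_subset KS) => O [o Oo] oO; apply: contrapT => OK.
suff : interior K o by rewrite K0.
rewrite /interior /=; apply: (filterS _ (open_nbhs_nbhs (conj oO Oo))) => z Oz.
by apply: contrapT => nKz; apply: OK; exists z.
Qed.

Lemma setD_interiorE {X : topologicalType} (A : set X) :
  [set: X] `\` interior A = closure (~` A).
Proof. by rewrite setTD -[A in LHS]setCK interiorC setCK. Qed.

(** If the closure split into A and B, bumping from a noncoastal point p of A
    would give a continuum through p and a coastal point that misses B. It must
    contain every noncoastal point, and some of these lie in B. *)
Lemma noncoastal_closure_connected {X : topologicalType} :
  hausdorff_space X -> bellamy [set: X] -> connected (closure (~` coastal X)).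
Proof.
move=> hX bX; have [[[_ cX conX] _] _] := bX.
set M := closure _.
have clM : closed M by apply: closed_closure.
apply: closed_connected => // A AM clA clB A0.
set B := M `\` A in clB.
(* F is relatively open in M, where the noncoastal points are dense. *)
have carries F : F !=set0 -> F `<=` M -> closed (M `\` F) ->
    exists2 p, F p & ~ coastal X p.
  move=> [f Ff] FM clF; have /FM := Ff.
  have nf : nbhs f (~` (M `\` F)).
    by apply: open_nbhs_nbhs; split; [exact: closed_openC|case].
  move/(_ _ nf) => [p [nSp nMFp]]; exists p => //.
  by apply: contrapT => nFp; apply: nMFp; split=> //; apply: subset_closure.
apply: contrapT => AM'.
have [b Bb] : B !=set0.
  apply: contrapT => B0; apply: AM'; apply/seteqP; split=> // x Mx.
  by apply: contrapT => nAx; apply: B0; exists x.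
have [p Ap nSp] := carries A A0 AM clB.
have [q Bq nSq] : exists2 q, B q & ~ coastal X q.
  apply: carries; [by exists b|by move=> x []|].
  by rewrite setDD setIC (setIidl AM).
have AB0 : A `&` B = set0 by apply/seteqP; split=> // x [Ax []].
have [U [V [oU oV AU BV UV0]]] :=
  disjoint_closed_separation hX cX clA clB AB0.
have clL : closed (~` V) by apply: open_closedC.
have UL : U `<=` ~` V.
  by move=> x Ux Vx; have : (U `&` V) x by []; rewrite UV0.
have LT : ~` V <> setT.
  by move/seteqP => [_ /(_ b I)]; apply; apply: BV.
have [C [cC Cp CL [y [Cy nUy]]]] :=
  continuum_leaving_open hX cX conX oU (AU p Ap) clL UL LT.
have Sy : coastal X y.
  apply: contrapT => nSy; have My : M y by apply: subset_closure.
  have [Ay|nAy] := pselect (A y); first exact/nUy/AU.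
  by apply: (CL y Cy); apply: BV.
have nSC : ~` coastal X `<=` C.
  by apply: noncoastal_sub_continuum => //; [exists y|move/(_ p Cp)].
exact: CL (nSC q nSq) (BV q Bq).
Qed.

(** A continuum C meeting both sides would contain all noncoastal points and,
    being closed, their closure. *)
Lemma noncoastal_closure_subcontinuum_dichotomy {X : topologicalType}
    {C : set X} :
  hausdorff_space X -> bellamy [set: X] ->
  proper_subcontinuum (closure (~` coastal X)) C ->
  C `<=` coastal X \/ C `&` coastal X = set0.
Proof.
move=> hX bX [[cC CM] CT].
have [CS|CS] := pselect (C `<=` coastal X); first by left.
right; apply/seteqP; split=> // x CSx; apply: CT; apply/seteqP; split=> //.
have clC : closed C by case: cC => _ /(compact_closed hX).
rewrite [C in _ `<=` C](iffLR (closure_id C) clC); apply: closureS.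
by apply: noncoastal_sub_continuum => //; exists x.
Qed.

(** The closure contains the coastal point s and the noncoastal point p, while
    each of its proper subcontinua lies on one side. Hence two of them cannot
    cover it, and the composant of p misses s. *)
Lemma noncoastal_closure_indecomposable {X : topologicalType} :
  hausdorff_space X -> bellamy [set: X] ->
  continuum (closure (~` coastal X)) ->
  closure (~` coastal X) `&` coastal X !=set0 -> ~` coastal X !=set0 ->
  indecomposable (closure (~` coastal X)) /\
  exists K L : set X,
    [/\ composants (closure (~` coastal X)) K,
        composants (closure (~` coastal X)) L & K <> L].
Proof.
move=> hX bX cM [s [Ms Ss]] [p nSp].
have dich := @noncoastal_closure_subcontinuum_dichotomy X _ hX bX.
have Mp : closure (~` coastal X) p by apply: subset_closure.
have inS A z : A `&` coastal X = set0 -> A z -> ~ coastal X z.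
  by move=> A0 Az Sz; have : (A `&` coastal X) z by []; rewrite A0.
split.
  split=> // -[A [B [pA pB MAB]]].
  have [[[_ cA _] AM] AT] := pA; have [[[_ cB _] BM] BT] := pB.
  (* A and B share a point because their union is connected, so they lie on
     the same side; but one of them contains s and one contains p. *)
  have noAB : A `&` B = set0 -> False.
    move=> AB0; have [_ _ conM] := cM.
    have clA := compact_closed hX cA; have clB := compact_closed hX cB.
    have [[A0 _ _] _] := pA.1; apply: AT; apply: conM => //.
      exists (~` B); first exact: closed_openC.
      rewrite MAB setIUl setICr setU0; apply/esym/setIidPl => x Ax Bx.
      by have : (A `&` B) x by []; rewrite AB0.
    by exists A => //; rewrite setIC; apply/esym/setIidPl.
  have [c [Ac Bc]] : A `&` B !=set0 by apply/set0P/eqP => /noAB.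
  have sAB : (A `|` B) s by rewrite -MAB.
  have pAB : (A `|` B) p by rewrite -MAB.
  have [AS|A0] := dich A pA; have [BS|B0] := dich B pB.
  - by apply: nSp; case: pAB => [/AS|/BS].
  - exact: inS B0 Bc (AS c Ac).
  - exact: inS A0 Ac (BS c Bc).
  - by case: sAB => [As|Bs]; [exact: inS A0 As Ss|exact: inS B0 Bs Ss].
exists (composant (closure (~` coastal X)) s),
  (composant (closure (~` coastal X)) p).
split; [by exists s|by exists p|].
have : composant (closure (~` coastal X)) s s.
  exists [set s] => //=; split=> //; split.
    by split; [exact: continuum1|move=> _ ->].
  by move=> E; apply: nSp; have : [set s] p; [rewrite E|move=> ->].
move=> + E; rewrite E => -[K [pK Kp] Ks].
have [KS|K0] := dich K pK; first exact/nSp/KS.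
exact: inS K0 Ks Ss.
Qed.

(** * Structure of the coastal set *)

Theorem theorem5p7 (H : topologicalType) (hausH : hausdorff_space H)
    (bellamyH : bellamy [set: H])
    (S_neq0 : coastal H <> set0) (S_neqT : coastal H <> setT) :
  [/\ semicontinuum (coastal H),
      dense (interior (coastal H)),
      (forall T : set H, semicontinuum T -> T <> setT ->
         interior T <> set0 -> T `<=` coastal H),
      subcontinuum [set: H] ([set: H] `\` interior (coastal H)) &
      open (coastal H) \/
      (indecomposable ([set: H] `\` interior (coastal H)) /\
       exists K L : set H,
         [/\ composants ([set: H] `\` interior (coastal H)) K,
             composants ([set: H] `\` interior (coastal H)) L & K <> L])].
Proof.
have [[[_ cH _] _] _] := bellamyH.
have nonempty (A : set H) : A <> set0 -> A !=set0 by move/eqP/set0P.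
have S0 := nonempty _ S_neq0.
have nS0 : ~` coastal H !=set0.
  by apply: nonempty; rewrite -setCT => /setC_inj.
have cM : continuum (closure (~` coastal H)).
  split; [|exact: subclosed_compact (@closed_closure _ _) cH (fun _ _ => I)|
    exact: noncoastal_closure_connected].
  by have [p nSp] := nS0; exists p; apply: subset_closure.
split.
- exact: coastal_semicontinuum.
- exact: coastal_interior_dense.
- move=> T sT TT /nonempty iT.
  exact: semicontinuum_interior_coastal hausH bellamyH.1 sT TT iT.
- by rewrite setD_interiorE.
- have [MS|MS] := pselect (closure (~` coastal H) `&` coastal H !=set0).
    by right; rewrite setD_interiorE; apply: noncoastal_closure_indecomposable.
  left; rewrite -closedC closure_id; apply/seteqP.
  split=> [|x Mx Sx]; first exact: subset_closure.
  by apply: MS; exists x.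
Qed.
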